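(* For any integers $0\leq m\leq n$ and any nonnegative integer $k$, $$\sum_{i=0}^{m}\binom{n}{i}=\sum_{i_1=0}^{k}\sum_{i_2=0}^{m-i_1}(-1)^{i_1}\binom{k}{i_1}\binom{n+k-i_1}{i_2}.$$
   Context: A sum whose upper limit is smaller than its lower limit (here the inner sum when $m-i_1<0$) is empty and equals $0$. *)

(* Defs.v *)
From mathcomp Require Import all_boot all_order all_algebra.

(* Main.v *)
Require Import Defs.
From mathcomp Require Import all_boot all_order all_algebra.
From mathcomp Require Import ring.
Set Implicit Arguments.
Unset Strict Implicit.
Unset Printing Implicit Defensive.
Import GRing.Theory.
Local Open Scope ring_scope.

(** Write [B(N, M)] for the sum of the first [M] entries of row [N] of Pascal's
    triangle. Pascal's rule gives [B(N, M) = B(N + 1, M) - B(N, M - 1)]; iterating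
    this [k] times expresses [B(n, M)] as a [k]-th finite difference of
    [i |-> B(n + k - i, M - i)]. *)

(** Pascal's rule splits ['C(k.+1, i.+1)]; the ['C(k, i)] half carries an extra sign and yields the
    [- f i.+1] terms. *)
Lemma sum_sign_bin_recr (R : comNzRingType) (k : nat) (f : nat -> R) :
  \sum_(0 <= i < k.+2) (-1) ^+ i * 'C(k.+1, i)%:R * f i =
  \sum_(0 <= i < k.+1) (-1) ^+ i * 'C(k, i)%:R * (f i - f i.+1).
Proof.
rewrite big_nat_recl //.
under eq_bigr => i _ do rewrite binS natrD mulrDr mulrDl.
rewrite big_split addrA /=.
have -> : (-1) ^+ 0 * 'C(k.+1, 0)%:R * f 0%N +
    \sum_(0 <= i < k.+1) (-1) ^+ i.+1 * 'C(k, i.+1)%:R * f i.+1 =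
  \sum_(0 <= i < k.+1) (-1) ^+ i * 'C(k, i)%:R * f i.
  (* The added term [i = k.+1] vanishes because ['C(k, k.+1)] is 0; the term [i = 0] can then be
     split off to match the left side. *)
  rewrite [RHS](_ : _ = \sum_(0 <= i < k.+2) (-1) ^+ i * 'C(k, i)%:R * f i).
    by rewrite [RHS]big_nat_recl // !bin0.
  by rewrite [RHS]big_nat_recr //= bin_small // mulr0 mul0r addr0.
rewrite -big_split; apply: eq_bigr => i _ /=.
by rewrite exprS; ring.
Qed.

(* When [M = 0] the truncated [M.-1] is harmless: all three sums are empty. *)
Lemma sum_bin_pascal (R : pzRingType) (N M : nat) :
  \sum_(0 <= i < M) 'C(N.+1, i)%:R - \sum_(0 <= i < M.-1) 'C(N, i)%:R =
  \sum_(0 <= i < M) 'C(N, i)%:R :> R.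
Proof.
case: M => [|M]; first by rewrite !big_geq // subr0.
rewrite big_nat_recl // [RHS]big_nat_recl // !bin0 -addrA -sumrB.
by congr (_ + _); apply: eq_bigr => i _; rewrite binS natrD addrK.
Qed.

Lemma sum_bin_alternating (R : comNzRingType) (n k M : nat) :
  \sum_(0 <= i < k.+1) (-1) ^+ i * 'C(k, i)%:R *
    \sum_(0 <= j < M - i) 'C(n + k - i, j)%:R =
  \sum_(0 <= j < M) 'C(n, j)%:R :> R.
Proof.
elim: k => [|k IHk].
  by rewrite big_nat1 expr0 bin0 !mul1r addn0 !subn0.
rewrite sum_sign_bin_recr -{}IHk.
apply: eq_big_nat => i /andP[_ le_ik]; congr (_ * _).
(* The difference is Pascal's rule at row [n + k - i] and length [M - i]; [i <= k] keeps the row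
   index from truncating. *)
by rewrite addnS subSS subnS subSn ?sum_bin_pascal // (leq_trans _ (leq_addl n k)).
Qed.

(* The range 0 <= i2 < m.+1 - i1 is 0 <= i2 <= m - i1 when i1 <= m, and is
   empty when i1 > m (the subtraction on nat is truncated). *)
Theorem corollary2p4 (m n k : nat) (le_mn : (m <= n)%N) :
  \sum_(0 <= i < m.+1) ('C(n, i))%:Z =
  \sum_(0 <= i1 < k.+1) \sum_(0 <= i2 < m.+1 - i1)
    (-1) ^+ i1 * ('C(k, i1))%:Z * ('C(n + k - i1, i2))%:Z.
Proof.
under eq_bigr => i _ do rewrite -natz.
rewrite -(sum_bin_alternating _ n k); apply: eq_bigr => i _.
by rewrite mulr_sumr; apply: eq_bigr => j _; rewrite !natz.
Qed.
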